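(* Let $n\in\{1,2,\dots\}$. Then $$MG_{n,\delta}\to\frac{1}{n!}\quad\text{as }\delta\downarrow n,\qquad MG_{n,\delta}\to\frac{1}{(n+1)!}\quad\text{as }\delta\uparrow n+1.$$
   Context: For $n\in\{1,2,\dots\}$ and $\delta\in(n,n+1)$, $$G_{n,\delta}(u)=(-1)^{n+1}\,\frac{e^{-u}-\Bigl(1-\frac{u^1}{1!}+\dots+(-1)^n\frac{u^n}{n!}\Bigr)}{u^{\delta}}\quad(u>0),\qquad G_{n,\delta}(0)=0,$$ and $MG_{n,\delta}=\max_{u\ge 0}G_{n,\delta}(u)$ (the maximum is attained). *)

(* Defs.v *)
From mathcomp Require Import all_boot all_order all_algebra.
From mathcomp Require Import all_classical all_reals all_analysis.

Set Implicit Arguments.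
Unset Strict Implicit.
Unset Printing Implicit Defensive.

Import Order.TTheory GRing.Theory Num.Theory.
Import numFieldNormedType.Exports.

Local Open Scope classical_set_scope.
Local Open Scope ring_scope.

(* The functions below are total in their real parameter delta; they are meant
   for delta in the open interval ]n, n + 1[. *)

Definition expN_taylor (R : realType) (n : nat) (u : R) : R :=
  \sum_(0 <= k < n.+1) (-1) ^+ k * (u ^+ k / k`!%:R).

Definition G (R : realType) (n : nat) (delta u : R) : R :=
  if 0 < u then
    (-1) ^+ n.+1 * ((expR (- u) - expN_taylor n u) / u `^ delta)
  else 0.

Definition maxima (R : realType) (A : set R) : set R := A `&` ubound A.

(* [maxima A] has at most one point; the default value 0 of [xget] is only
   returned when the maximum is not attained, which does not happen for
   1 <= n and n < delta < n + 1. *)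
Definition MG (R : realType) (n : nat) (delta : R) : R :=
  xget 0 (maxima [set G n delta u | u in [set u : R | 0 <= u]]).

(* Main.v *)
Require Import Defs.
From mathcomp Require Import all_boot all_order all_algebra.
From mathcomp Require Import all_classical all_reals all_analysis.
From mathcomp Require Import ring lra.

Set Implicit Arguments.
Unset Strict Implicit.
Unset Printing Implicit Defensive.

Import Order.TTheory GRing.Theory Num.Theory.
Import numFieldNormedType.Exports.

Local Open Scope classical_set_scope.
Local Open Scope ring_scope.

(** Let g_n(u) = (-1)^(n+1) (e^(-u) - T_n(u)) be the signed remainder of the
    Taylor polynomial T_n of e^(-u), so that G_{n,delta}(u) = g_n(u) / u^delta
    for u > 0. Adding one term to the polynomial gives
      g_{n+1}(u) = u^(n+1)/(n+1)! - g_n(u),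
    and g_{n+1}' = g_n with g_n(0) = 0, so by induction every g_n is
    nonnegative on u >= 0. Nonnegativity fed back into the recurrence encloses
    each remainder by its neighbouring terms:
      g_n <= u^n/n!   and   g_n <= u^(n+1)/(n+1)!,
    the first being sharp as u -> oo and the second as u -> 0.

    Upper bound. For n < delta < n+1 the two bounds on G_{n,delta} are
    u^(n-delta)/n!, decreasing in u, and u^(n+1-delta)/(n+1)!, increasing in u.
    They cross at u = n+1, so the maximum is at most their common value there,
      (n+1)^(n-delta)/n!                                    ([G_upper_bound]).
    This single expression is continuous in delta, and tends to 1/n! as delta
    tends to n and to 1/(n+1)! as delta tends to n+1. The increasing bound
    tends to 0 at 0 and the decreasing one at infinity, so the maximum is
    attained ([G_max_attained]).

    Lower bound. The maximum dominates G_{n,delta}(u) for each fixed u, and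
    G_{n,delta}(u) tends to g_n(u)/u^a as delta tends to a. It remains to make
    g_n(u)/u^a as close as desired to the limit: take u large when a = n
    ([remainder_ratio_near_infty]) and u small when a = n+1
    ([remainder_ratio_near0]). The two one-sided limits are then the two
    instances of [cvg_MG]. *)

(** * Remainders of the Taylor polynomials of exp(-u) *)

Definition remainder (R : realType) (n : nat) (u : R) : R :=
  (-1) ^+ n.+1 * (expR (- u) - expN_taylor n u).

Lemma remainder0E (R : realType) (u : R) : remainder 0 u = 1 - expR (- u).
Proof.
rewrite /remainder /expN_taylor big_nat1 expr0 expr1 fact0 divr1 expr0.
by ring.
Qed.

Lemma remainderS (R : realType) (n : nat) (u : R) :
  remainder n.+1 u = u ^+ n.+1 / n.+1`!%:R - remainder n u.
Proof.
rewrite /remainder /expN_taylor big_nat_recr //=.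
set s := \sum_(_ <= _ < _) _.
have sign_sq : (-1) ^+ n.+1 * (-1) ^+ n.+1 = 1 :> R.
  by rewrite -expr2 sqrr_sign.
rewrite (exprS _ n.+1) mulrBr mulrDr !mulN1r opprD.
rewrite !mulNr mulrA sign_sq mul1r; ring.
Qed.

Lemma remainder_at0 (R : realType) (n : nat) : remainder n (0 : R) = 0.
Proof.
elim: n => [|n IHn]; first by rewrite remainder0E oppr0 expR0 subrr.
by rewrite remainderS IHn expr0n mul0r subr0.
Qed.

Lemma is_derive_expR_opp (R : realType) (x : R) :
  is_derive x 1 (fun u => expR (- u)) (- expR (- x)).
Proof.
have -> : (fun u : R => expR (- u)) = expR \o -%R by [].
by apply: is_derive_eq; rewrite mulrN1.
Qed.

Lemma is_derive_monomial_fact (R : realType) (n : nat) (x : R) :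
  is_derive x 1 (fun u => u ^+ n.+1 / n.+1`!%:R) (x ^+ n / n`!%:R).
Proof.
have -> : (fun u : R => u ^+ n.+1 / n.+1`!%:R) =
    (n.+1`!%:R)^-1 \*: (id ^+ n.+1).
  by apply/funext => u /=; rewrite fctE /= /GRing.scale /= mulrC.
apply: is_derive_eq; rewrite /GRing.scale /= mulr1 factS natrM.
have := @fact_gt0 n; rewrite -(ltr_nat R) => fact_pos.
by field; rewrite gt_eqF //= nat1r pnatr_eq0.
Qed.

(** Induction on the recurrence [remainderS] avoids differentiating the sum
    that defines the Taylor polynomial. *)
Lemma is_derive_remainder (R : realType) (n : nat) (x : R) :
  is_derive x 1 (remainder n.+1) (remainder n x).
Proof.
elim: n x => [|n IHn] x.
  have -> : @remainder R 1 = (fun u => u ^+ 1 / 1`!%:R) - (cst 1 - (fun u => expR (- u))).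
    by apply/funext => u; rewrite remainderS remainder0E !fctE.
  have := is_derive_monomial_fact 0 x => dm; have := is_derive_expR_opp x => de.
  apply: is_derive_eq; rewrite remainder0E fact0 expr0 divr1; ring.
have -> : @remainder R n.+2 = (fun u => u ^+ n.+2 / n.+2`!%:R) - remainder n.+1.
  by apply/funext => u; rewrite remainderS !fctE.
have := is_derive_monomial_fact n.+1 x => dm; have := IHn x => dr.
by apply: is_derive_eq; rewrite remainderS.
Qed.

(** The derivative of [remainder n.+1] is [remainder n] and all remainders
    vanish at 0, so nonnegativity passes from each remainder to the next. *)
Lemma remainder_ge0 (R : realType) (n : nat) (u : R) :
  0 <= u -> 0 <= remainder n u.
Proof.
elim: n u => [|n IHn] u u0.
  by rewrite remainder0E subr_ge0 -expR0 ler_expR oppr_le0.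
rewrite -(remainder_at0 R n.+1).
apply: (@ger0_derive1_ndecr R (remainder n.+1) 0 u) => // x.
- move=> _; exact: (@ex_derive _ _ _ _ _ _ _ (is_derive_remainder n x)).
- rewrite in_itv /= => /andP[x0 _]; rewrite derive1E.
  by rewrite (@derive_val _ _ _ _ _ _ _ (is_derive_remainder n x)) IHn ?ltW.
- apply: derivable_within_continuous => y _.
  exact: (@ex_derive _ _ _ _ _ _ _ (is_derive_remainder n y)).
Qed.

(** The next two bounds are the nonnegativity of the following, respectively
    the preceding, remainder; at [n = 0] the role of the preceding remainder is
    played by [expR (- u)]. *)
Lemma remainder_le_next (R : realType) (n : nat) (u : R) :
  0 <= u -> remainder n u <= u ^+ n.+1 / n.+1`!%:R.
Proof.
by move=> u0; have := remainder_ge0 n.+1 u0; rewrite remainderS subr_ge0.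
Qed.

Lemma remainder_le_last (R : realType) (n : nat) (u : R) :
  0 <= u -> remainder n u <= u ^+ n / n`!%:R.
Proof.
case: n => [|n] u0.
  by rewrite remainder0E expr0 fact0 divr1 gerBl expR_ge0.
by rewrite remainderS gerBl remainder_ge0.
Qed.

Lemma remainder_ge_next (R : realType) (n : nat) (u : R) : 0 <= u ->
  u ^+ n.+1 / n.+1`!%:R - u ^+ n.+2 / n.+2`!%:R <= remainder n u.
Proof.
by move=> u0; have := remainder_le_next n.+1 u0; rewrite remainderS; lra.
Qed.

Lemma remainder_ge_last (R : realType) (n : nat) (u : R) : 0 <= u ->
  u ^+ n.+1 / n.+1`!%:R - u ^+ n / n`!%:R <= remainder n.+1 u.
Proof. by move=> u0; rewrite remainderS lerD2l lerN2 remainder_le_last. Qed.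

(** At [u = 1] the lower bound [remainder_ge_next] is a difference of
    consecutive inverse factorials, which are distinct as [n.+2 > 1]. *)
Lemma remainder1_gt0 (R : realType) (n : nat) : 0 < remainder n (1 : R).
Proof.
apply: lt_le_trans (remainder_ge_next n ler01); rewrite !expr1n !div1r subr_gt0.
rewrite ltf_pV2 ?posrE ?ltr0n ?fact_gt0 // ltr_nat [ltnRHS]factS.
by rewrite ltn_Pmull ?fact_gt0.
Qed.

(** By [remainder_ge_last] the ratio is at least [1 / n.+1`! - 1 / (u * n`!)];
    the chosen [u] makes the error term equal to half the gap between [c] and
    the limit. *)
Lemma remainder_ratio_near_infty (R : realType) (n : nat) (c : R) :
  c < 1 / n.+1`!%:R ->
  exists2 u : R, 0 < u & c < remainder n.+1 u / u ^+ n.+1.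
Proof.
move=> cL; have fact_pos m : 0 < m`!%:R :> R by rewrite ltr0n fact_gt0.
pose e := 1 / n.+1`!%:R - c; have e0 : 0 < e by rewrite subr_gt0.
pose u := 2 / (n`!%:R * e).
have u0 : 0 < u by rewrite divr_gt0 ?mulr_gt0.
exists u => //; rewrite ltr_pdivlMr ?exprn_gt0 //.
apply: lt_le_trans (remainder_ge_last n (ltW u0)).
rewrite -subr_gt0 (_ : _ - _ = u ^+ n / n`!%:R).
  by rewrite divr_gt0 ?exprn_gt0.
have -> : c = 1 / n.+1`!%:R - e by rewrite /e; ring.
rewrite exprS; have -> : e = 2 / (n`!%:R * u).
  by rewrite /u; field; rewrite !gt_eqF //.
by field; rewrite !gt_eqF //.
Qed.

(** By [remainder_ge_next] the ratio is at least [1 / n.+1`! - u / n.+2`!];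
    the chosen [u] makes the error term equal to half the gap between [c] and
    the limit. *)
Lemma remainder_ratio_near0 (R : realType) (n : nat) (c : R) :
  c < 1 / n.+1`!%:R -> exists2 u : R, 0 < u & c < remainder n u / u ^+ n.+1.
Proof.
move=> cL; have fact_pos m : 0 < m`!%:R :> R by rewrite ltr0n fact_gt0.
pose e := 1 / n.+1`!%:R - c; have e0 : 0 < e by rewrite subr_gt0.
pose u := n.+2`!%:R * e / 2.
have u0 : 0 < u by rewrite divr_gt0 ?mulr_gt0.
exists u => //; rewrite ltr_pdivlMr ?exprn_gt0 //.
apply: lt_le_trans (remainder_ge_next n (ltW u0)).
rewrite -subr_gt0 (_ : _ - _ = u ^+ n.+2 / n.+2`!%:R).
  by rewrite divr_gt0 ?exprn_gt0.
have -> : c = 1 / n.+1`!%:R - e by rewrite /e; ring.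
rewrite [u ^+ n.+2]exprS; have -> : e = 2 * u / n.+2`!%:R.
  by rewrite /u; field; rewrite !gt_eqF //.
by field; rewrite !gt_eqF //.
Qed.

(** * The maximum of G: upper bound and attainment *)

Lemma GE (R : realType) (n : nat) (delta u : R) : 0 < u ->
  G n delta u = remainder n u / u `^ delta.
Proof. by move=> u0; rewrite /G u0 mulrA. Qed.

Lemma G_le_next (R : realType) (n : nat) (delta u : R) : 0 < u ->
  G n delta u <= u `^ (n.+1%:R - delta) / n.+1`!%:R.
Proof.
move=> u0; rewrite GE // powRB ?(gt_eqF u0) ?implybT // powR_mulrn ?(ltW u0) //.
by rewrite [leRHS]mulrAC ler_pM2r ?invr_gt0 ?powR_gt0 // remainder_le_next ?ltW.
Qed.

Lemma G_le_last (R : realType) (n : nat) (delta u : R) : 0 < u ->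
  G n delta u <= u `^ (n%:R - delta) / n`!%:R.
Proof.
move=> u0; rewrite GE // powRB ?(gt_eqF u0) ?implybT // powR_mulrn ?(ltW u0) //.
by rewrite [leRHS]mulrAC ler_pM2r ?invr_gt0 ?powR_gt0 // remainder_le_last ?ltW.
Qed.

Lemma ler_powR_base (R : realType) (x y r : R) : 0 <= r -> 0 <= x -> x <= y ->
  x `^ r <= y `^ r.
Proof.
move=> r0 x0 xy; apply: ge0_ler_powR; rewrite ?nnegrE //.
exact: le_trans x0 xy.
Qed.

Lemma ger_powR_base (R : realType) (x y r : R) : r <= 0 -> 0 < x -> x <= y ->
  y `^ r <= x `^ r.
Proof.
move=> r0 x0 xy; have y0 := lt_le_trans x0 xy.
rewrite -(opprK r) !(powRN _ (- r)) lef_pV2 ?posrE ?powR_gt0 //.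
by apply: ler_powR_base; rewrite ?oppr_ge0 // ltW.
Qed.

(** The bound is the common value at [u = n.+1] of the increasing bound
    [G_le_next], used to the left of that point, and of the decreasing bound
    [G_le_last], used to its right. *)
Lemma G_upper_bound (R : realType) (n : nat) (delta u : R) :
  n%:R < delta < n.+1%:R ->
  G n delta u <= n.+1%:R `^ (n%:R - delta) / n`!%:R.
Proof.
move=> /andP[nd dn].
have fact_pos m : 0 < m`!%:R :> R by rewrite ltr0n fact_gt0.
case: (ltP 0 u) => [u0|u0]; last first.
  by rewrite /G ltNge u0 /= divr_ge0 ?powR_ge0 ?ltW.
case: (leP u n.+1%:R) => [un|nu].
  apply: le_trans (G_le_next _ _ u0) _.
  have -> : n.+1%:R `^ (n%:R - delta) / n`!%:R =
      n.+1%:R `^ (n.+1%:R - delta) / n.+1`!%:R :> R.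
    rewrite (_ : n.+1%:R - delta = 1 + (n%:R - delta)); last first.
      by rewrite -natr1; ring.
    rewrite [in RHS]powRD; last by rewrite pnatr_eq0 implybT.
    rewrite powRr1 // factS natrM invfM mulrACA divff ?mul1r //.
  rewrite ler_pM2r ?invr_gt0 //.
  by apply: ler_powR_base; rewrite ?subr_ge0 // ltW.
apply: le_trans (G_le_last _ _ u0) _; rewrite ler_pM2r ?invr_gt0 //.
by apply: ger_powR_base; rewrite ?subr_le0 ?ltr0n // ltW.
Qed.

(** [G_le_next] and [G_le_last] keep [G n delta] from exceeding its positive
    value at 1 outside a compact interval of positive numbers, on which the
    extreme value theorem applies. *)
Lemma G_max_attained (R : realType) (n : nat) (delta : R) :
  n%:R < delta < n.+1%:R -> exists2 c, 0 < c & forall u, G n delta u <= G n delta c.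
Proof.
move=> /andP[nd dn].
have fact_pos m : 0 < m`!%:R :> R by rewrite ltr0n fact_gt0.
have g0 := remainder1_gt0 R n; set g := remainder n 1 in g0.
have G1 : G n delta 1 = g by rewrite GE // powR1 divr1.
have r0 : n.+1%:R - delta != 0 by rewrite subr_eq0 gt_eqF.
have s0 : n%:R - delta != 0 by rewrite subr_eq0 lt_eqF.
(* [a] and [b] are where the small-[u] and the large-[u] bound equal [g]. *)
pose a := (g * n.+1`!%:R) `^ (n.+1%:R - delta)^-1.
pose b := (g * n`!%:R) `^ (n%:R - delta)^-1.
have a0 : 0 < a by rewrite /a powR_gt0 // mulr_gt0.
have b0 : 0 < b by rewrite /b powR_gt0 // mulr_gt0.
have small u : 0 < u -> u <= a -> G n delta u <= g.
  move=> u0 ua; apply: le_trans (G_le_next _ _ u0) _.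
  rewrite ler_pdivrMr //; apply: le_trans (ler_powR_base _ (ltW u0) ua) _.
    by rewrite subr_ge0 ltW.
  by rewrite -powRrM mulVf // powRr1 // mulr_ge0 // ltW.
have large u : b <= u -> G n delta u <= g.
  move=> bu; apply: le_trans (G_le_last _ _ (lt_le_trans b0 bu)) _.
  rewrite ler_pdivrMr //; apply: le_trans (ger_powR_base _ b0 bu) _.
    by rewrite subr_le0 ltW.
  by rewrite -powRrM mulVf // powRr1 // mulr_ge0 // ltW.
(* Enlarging the interval to contain 1 makes its maximum at least [g]. *)
pose a' := Num.min a 1; pose b' := Num.max b 1.
have a'0 : 0 < a' by rewrite lt_min a0 ltr01.
have a'1 : a' <= 1 by rewrite ge_min lexx orbT.
have b'1 : 1 <= b' by rewrite le_max lexx orbT.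
(* Negating the exponent makes the function a product, differentiable on the
   interval as the interval stays away from 0. *)
have [||c] := @EVT_max R (fun u => remainder n u * u `^ (- delta)) a' b'.
- exact: le_trans b'1.
- apply: derivable_within_continuous => x; rewrite in_itv /= => /andP[ax _].
  have x0 := lt_le_trans a'0 ax.
  apply: derivableM.
    (* Reading the recurrence backwards covers [n = 0] too. *)
    have -> : @remainder R n = (fun u => u ^+ n.+1 / n.+1`!%:R) - remainder n.+1.
      by apply/funext => u; rewrite !fctE remainderS opprB addrC subrK.
    apply: derivableB.
      exact: (@ex_derive _ _ _ _ _ _ _ (is_derive_monomial_fact n x)).
    exact: (@ex_derive _ _ _ _ _ _ _ (is_derive_remainder n x)).
  exact: (@ex_derive _ _ _ _ _ _ _ (is_derive1_powR (- delta) x0)).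
rewrite in_itv /= => /andP[ac cb] cmax.
have c0 := lt_le_trans a'0 ac.
have inside u : a' <= u -> u <= b' -> G n delta u <= G n delta c.
  move=> au ub; rewrite !GE ?(lt_le_trans a'0) // -!powRN.
  by apply: cmax; rewrite in_itv /= au.
have gc : g <= G n delta c by rewrite -G1 inside.
exists c => // u.
case: (ltP 0 u) => [u0|u0]; last by rewrite {1}/G ltNge u0 /= (le_trans (ltW g0)).
case: (leP u a) => [ua|au]; first by rewrite (le_trans (small _ u0 ua)).
case: (leP b u) => [bu|ub]; first by rewrite (le_trans (large _ bu)).
by apply: inside; rewrite ?ge_min ?le_max ltW.
Qed.

Lemma MG_is_max (R : realType) (n : nat) (delta : R) :
  n%:R < delta < n.+1%:R ->
  (exists u, MG n delta = G n delta u) /\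
  (forall u, 0 <= u -> G n delta u <= MG n delta).
Proof.
move=> hd; have [c c0 cmax] := G_max_attained hd.
have ex_max : exists x, maxima [set G n delta u | u in [set u : R | 0 <= u]] x.
  exists (G n delta c); split; first by exists c => //=; rewrite ltW.
  by move=> _ [u _ <-].
have [[u _ GM] ub] := xgetPex 0 ex_max; split; first by exists u; rewrite GM.
by move=> v v0; apply: ub; exists v.
Qed.

(** * Limits of the maximum *)

Lemma continuous_powR_exponent (R : realType) (x : R) :
  0 < x -> continuous (fun r : R => x `^ r).
Proof.
move=> x0 r.
have -> : (fun r : R => x `^ r) = (fun r => expR (r * ln x)).
  by apply/funext => s; rewrite /powR gt_eqF.
apply: (cvg_comp (fun r => r * ln x) expR); last exact: continuous_expR.
exact: mulrr_continuous.
Qed.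

(** A squeeze valid at both end points: [G_upper_bound] from above, and from
    below the value of [G n delta] at a fixed [u], whose limit
    [remainder n u / u `^ a] is within reach of the target by hypothesis. *)
Lemma cvg_MG (R : realType) (n : nat) (a : R) (F : set_system R)
    (FF : ProperFilter F) :
  F --> a -> (\forall delta \near F, n%:R < delta < n.+1%:R) ->
  (forall c, c < n.+1%:R `^ (n%:R - a) / n`!%:R ->
     exists2 u : R, 0 < u & c < remainder n u / u `^ a) ->
  MG n delta @[delta --> F] --> (n.+1%:R `^ (n%:R - a) / n`!%:R : R).
Proof.
move=> Fa Fn approx; set L := _ / _ in approx *.
have upper : n.+1%:R `^ (n%:R - delta) / n`!%:R @[delta --> F] --> L.
  apply: cvgM; last exact: cvg_cst.
  apply: (@cvg_comp _ _ _ (fun delta => n%:R - delta) (powR n.+1%:R) _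
    (nbhs (n%:R - a))).
    by apply: cvgB => //; apply: cvg_cst.
  exact: continuous_powR_exponent.
apply/cvgrPdist_lt => e e0.
have [|u u0 uL] := approx (L - e); first by rewrite gtrBl.
have lower : G n delta u @[delta --> F] --> remainder n u / u `^ a.
  under eq_fun do rewrite GE //.
  apply: cvgM; first exact: cvg_cst.
  apply: cvgV; first by rewrite gt_eqF ?powR_gt0.
  exact: (cvg_trans (cvg_app (powR u) Fa) (@continuous_powR_exponent _ _ u0 a)).
near=> delta.
have hd : n%:R < delta < n.+1%:R by near: delta.
have [[v MGv] MGub] := MG_is_max hd.
rewrite ltr_norml; apply/andP; split.
  rewrite ltrBrDl ltrBlDr; apply: (@le_lt_trans _ _ (n.+1%:R `^ (n%:R - delta) / n`!%:R)).
    by rewrite MGv G_upper_bound.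
  near: delta; apply: (cvgr_lt L upper); by rewrite ltrDl.
rewrite ltrBlDr -ltrBlDl; apply: lt_le_trans (MGub _ (ltW u0)).
by near: delta; apply: (cvgr_gt (remainder n u / u `^ a) lower).
Unshelve. all: by end_near. Qed.

Theorem proposition22 (R : realType) (n : nat) (hn : (1 <= n)%N) :
  (MG n delta @[delta --> (n%:R : R)^'+] --> (1 / n`!%:R : R)) /\
  (MG n delta @[delta --> (n.+1%:R : R)^'-] --> (1 / (n.+1)`!%:R : R)).
Proof.
split.
  have L : n.+1%:R `^ (n%:R - n%:R) / n`!%:R = 1 / n`!%:R :> R.
    by rewrite subrr powRr0.
  rewrite -L; apply: cvg_MG.
  - exact: cvg_at_right_filter.
  - near=> d; apply/andP; split; near: d; first exact: nbhs_right_gt.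
    by apply: nbhs_right_lt; rewrite ltr_nat.
  - rewrite L => c; case: n hn {L} => // n _ /remainder_ratio_near_infty[u u0 cu].
    by exists u => //; rewrite powR_mulrn // ltW.
have L : n.+1%:R `^ (n%:R - n.+1%:R) / n`!%:R = 1 / n.+1`!%:R :> R.
  rewrite -natr1 opprD addNKr powR_inv1 ?addr_ge0 // natr1.
  by rewrite factS natrM -invfM div1r.
rewrite -L; apply: cvg_MG.
- exact: cvg_at_left_filter.
- near=> d; apply/andP; split; near: d; last exact: nbhs_left_lt.
  by apply: nbhs_left_gt; rewrite ltr_nat.
- rewrite L => c /remainder_ratio_near0[u u0 cu].
  by exists u => //; rewrite powR_mulrn // ltW.
Unshelve. all: by end_near. Qed.
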